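(* Let $(n,m,k)\in\mathcal{R}_{odd,sym}^{orth}$. (a) For every collection $\phi_1,\ldots,\phi_m$ of $m$ odd continuous maps $S^{n-1}\to S^{n-1}$ there exists an orthonormal $k$-frame $(e_1,\ldots,e_k)$ in $\mathbb{R}^n$ such that for every $1\le l\le m$ the tuple $(\phi_l(e_1),\ldots,\phi_l(e_k))$ is also an orthonormal frame. (b) For every collection $g_1,\ldots,g_m$ of $m$ continuous even functions $\mathbb{R}^n\to\mathbb{R}$ there exists an orthonormal $k$-frame $(e_1,\ldots,e_k)$ in $\mathbb{R}^n$ such that for all $1\le l\le m$ and $1\le i<j\le k$ $$g_l(e_i+e_j)=g_l(e_i-e_j).$$
   Context: A continuous function $f:S^{n-1}\times S^{n-1}\to\mathbb{R}$ is called odd if $f(-x,y)=-f(x,y)$ and $f(x,-y)=-f(x,y)$ for all $x,y$, and symmetric if $f(x,y)=f(y,x)$ for all $x,y$. $\mathcal{R}_{odd,sym}^{orth}$ is the set of triples $(n,m,k)$ of positive integers such that for any $m$ odd and symmetric functions $f_1,\ldots,f_m:S^{n-1}\times S^{n-1}\to\mathbb{R}$ there exists an orthonormal $k$-frame $(e_1,\ldots,e_k)$ in $\mathbb{R}^n$ with $f_l(e_i,e_j)=0$ for all $1\le l\le m$ and $1\le i<j\le k$. A map $\phi:S^{n-1}\to S^{n-1}$ is odd if $\phi(-x)=-\phi(x)$; a function $g:\mathbb{R}^n\to\mathbb{R}$ is even if $g(-x)=g(x)$. *)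

(* Defs.v *)
From mathcomp Require Import all_boot all_order all_algebra.
From mathcomp Require Import all_classical all_reals all_analysis.

Set Implicit Arguments.
Unset Strict Implicit.
Unset Printing Implicit Defensive.

Import Order.TTheory GRing.Theory Num.Theory.
Import numFieldNormedType.Exports.

Local Open Scope classical_set_scope.
Local Open Scope ring_scope.

(* The library norm on 'rV[R]_n is the sup norm, so the Euclidean structure is
   introduced here. The two norms induce the same topology. *)
Definition dot (R : realType) (n : nat) (x y : 'rV[R]_n) : R :=
  \sum_(i < n) x 0 i * y 0 i.

(* S^(n-1), as a subset of R^n. *)
Definition unit_sphere (R : realType) (n : nat) : set 'rV[R]_n :=
  [set x | Num.sqrt (dot x x) = 1].

Definition orthonormal_frame (R : realType) (n k : nat)
    (e : 'I_k -> 'rV[R]_n) : Prop :=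
  forall i j : 'I_k, dot (e i) (e j) = (i == j)%:R.

(* A function on S^(n-1) x S^(n-1) is represented by a total function on
   R^n x R^n, of which only the values on the product of spheres matter:
   continuity is for the subspace topology, and the equations below are
   required on the spheres only. *)
Definition continuous_on_spheres (R : realType) (n : nat)
    (f : 'rV[R]_n * 'rV[R]_n -> R) : Prop :=
  {within @unit_sphere R n `*` @unit_sphere R n, continuous f}.

Definition odd_on_spheres (R : realType) (n : nat)
    (f : 'rV[R]_n * 'rV[R]_n -> R) : Prop :=
  forall x y, unit_sphere x -> unit_sphere y ->
    f (- x, y) = - f (x, y) /\ f (x, - y) = - f (x, y).

Definition symmetric_on_spheres (R : realType) (n : nat)
    (f : 'rV[R]_n * 'rV[R]_n -> R) : Prop :=
  forall x y, unit_sphere x -> unit_sphere y -> f (x, y) = f (y, x).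

Definition R_orth_odd_sym (R : realType) : set (nat * nat * nat) :=
  [set nmk | let: (n, m, k) := nmk in
    [/\ (0 < n)%N, (0 < m)%N, (0 < k)%N &
     forall f : 'I_m -> 'rV[R]_n * 'rV[R]_n -> R,
       (forall l, [/\ continuous_on_spheres (f l), odd_on_spheres (f l)
                    & symmetric_on_spheres (f l)]) ->
       exists e : 'I_k -> 'rV[R]_n, orthonormal_frame e /\
         forall (l : 'I_m) (i j : 'I_k), (i < j)%N -> f l (e i, e j) = 0]].

(* Odd continuous maps S^(n-1) -> S^(n-1), with the same convention. *)
Definition odd_sphere_map (R : realType) (n : nat)
    (phi : 'rV[R]_n -> 'rV[R]_n) : Prop :=
  [/\ set_fun (@unit_sphere R n) (@unit_sphere R n) phi,
      {within @unit_sphere R n, continuous phi}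
    & forall x, unit_sphere x -> phi (- x) = - phi x].

(* Main.v *)
Require Import Defs.
From mathcomp Require Import all_boot all_order all_algebra.
From mathcomp Require Import all_classical all_reals all_analysis.
Import Order.TTheory GRing.Theory Num.Theory.
Import numFieldNormedType.Exports.
Local Open Scope classical_set_scope.
Local Open Scope ring_scope.

(** Both parts apply the defining property of the triple to suitable test
    functions on pairs of unit vectors. For (a) take the inner product of
    [phi l x] and [phi l y]: it is symmetric, odd because [phi l] is odd, and
    its vanishing on a frame says that the image vectors are orthogonal, while
    they are unit vectors because [phi l] preserves the sphere. For (b) take
    [g l (x + y) - g l (x - y)]: evenness of [g l] makes it odd in each
    variable and symmetric. The continuity of the first function rests on
    [dot_cvg] and [within_setM_fst], [within_setM_snd]. *)

Lemma dotC (R : realType) (n : nat) (x y : 'rV[R]_n) : dot x y = dot y x.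
Proof. by apply: eq_bigr => i _; rewrite mulrC. Qed.

Lemma dotNl (R : realType) (n : nat) (x y : 'rV[R]_n) :
  dot (- x) y = - dot x y.
Proof. by rewrite /dot -sumrN; apply: eq_bigr => i _; rewrite mxE mulNr. Qed.

Lemma dot_unit_sphere (R : realType) (n : nat) (x : 'rV[R]_n) :
  unit_sphere x <-> dot x x = 1.
Proof.
rewrite /unit_sphere /=; split=> [xS|->]; last exact: sqrtr1.
have x_ge0 : 0 <= dot x x.
  by apply: sumr_ge0 => i _; rewrite -expr2 sqr_ge0.
by rewrite -(sqr_sqrtr x_ge0) xS expr1n.
Qed.

Lemma orthonormal_frame_unit_sphere (R : realType) (n k : nat)
    (e : 'I_k -> 'rV[R]_n) (i : 'I_k) :
  orthonormal_frame e -> unit_sphere (e i).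
Proof. by move=> he; apply/dot_unit_sphere; rewrite he eqxx. Qed.

(** By symmetry of the inner product, orthogonality need only be checked on
    increasing pairs of indices. *)
Lemma orthonormal_frame_lt (R : realType) (n k : nat)
    (e : 'I_k -> 'rV[R]_n) :
  (forall i, unit_sphere (e i)) ->
  (forall i j : 'I_k, (i < j)%N -> dot (e i) (e j) = 0) ->
  orthonormal_frame e.
Proof.
move=> eS e0 i j; rewrite -val_eqE /=; case: ltngtP => [ij|ji|/val_inj <-].
- exact: e0.
- by rewrite dotC; exact: e0.
- by apply/dot_unit_sphere.
Qed.

Lemma dot_cvg (R : realType) (n : nat) (T : Type) (F : set_system T)
    (FF : Filter F) (u v : T -> 'rV[R]_n) (a b : 'rV[R]_n) :
  u @ F --> a -> v @ F --> b -> dot (u t) (v t) @[t --> F] --> dot a b.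
Proof.
move=> ua vb; rewrite /dot; apply: cvg_big => [|i _].
  exact: add_continuous.
apply: cvgM.
- exact: (continuous_cvg _ (@coord_continuous _ _ _ 0 i a) ua).
- exact: (continuous_cvg _ (@coord_continuous _ _ _ 0 i b) vb).
Qed.

Lemma within_setM_fst (T U : topologicalType) (A : set T) (B : set U)
    (p : T * U) :
  fst @ within (A `*` B) (nbhs p) --> within A (nbhs p.1).
Proof.
move=> V AV.
have : nbhs p (fst @^-1` [set x | A x -> V x]) by exact: cvg_fst.
by apply: (@filterS _ (nbhs p)) => -[x y] /= + [Ax _]; apply.
Qed.

Lemma within_setM_snd (T U : topologicalType) (A : set T) (B : set U)
    (p : T * U) :
  snd @ within (A `*` B) (nbhs p) --> within B (nbhs p.2).
Proof.
move=> V BV.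
have : nbhs p (snd @^-1` [set x | B x -> V x]) by exact: cvg_snd.
by apply: (@filterS _ (nbhs p)) => -[x y] /= + [_ By]; apply.
Qed.

Lemma continuous_on_spheres_dot (R : realType) (n : nat)
    (phi : 'rV[R]_n -> 'rV[R]_n) :
  {within @unit_sphere R n, continuous phi} ->
  continuous_on_spheres (fun p => dot (phi p.1) (phi p.2)).
Proof.
move=> /subspace_continuousP cphi; apply/subspace_continuousP => p [p1S p2S].
apply: dot_cvg.
- exact: (cvg_comp _ _ (@within_setM_fst _ _ _ _ p) (cphi _ p1S)).
- exact: (cvg_comp _ _ (@within_setM_snd _ _ _ _ p) (cphi _ p2S)).
Qed.

Lemma continuous_on_spheres_diff (R : realType) (n : nat)
    (g : 'rV[R]_n -> R) :
  continuous g ->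
  continuous_on_spheres (fun p => g (p.1 + p.2) - g (p.1 - p.2)).
Proof.
move=> cg; apply: continuous_subspaceT => p.
have c1 : fst @ p --> p.1 by exact: cvg_fst.
have c2 : snd @ p --> p.2 by exact: cvg_snd.
apply: cvgB.
- apply: (cvg_comp _ g _ (cg _)); exact: cvgD.
- apply: (cvg_comp _ g _ (cg _)); exact: cvgB.
Qed.

Theorem corollary3 (R : realType) (n m k : nat)
    (hnmk : R_orth_odd_sym R (n, m, k)) :
  (forall phi : 'I_m -> 'rV[R]_n -> 'rV[R]_n,
     (forall l : 'I_m, odd_sphere_map (phi l)) ->
     exists e : 'I_k -> 'rV[R]_n,
       orthonormal_frame e /\
       forall l : 'I_m, orthonormal_frame (fun i : 'I_k => phi l (e i))) /\
  (forall g : 'I_m -> 'rV[R]_n -> R,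
     (forall l : 'I_m,
        continuous (g l) /\ (forall x : 'rV[R]_n, g l (- x) = g l x)) ->
     exists e : 'I_k -> 'rV[R]_n,
       orthonormal_frame e /\
       forall (l : 'I_m) (i j : 'I_k), (i < j)%N ->
         g l (e i + e j) = g l (e i - e j)).
Proof.
case: hnmk => _ _ _ frameP; split=> [phi hphi | g hg].
- have [l|e [eON e0]] := frameP (fun l p => dot (phi l p.1) (phi l p.2)).
    have [_ cphi oddphi] := hphi l; split.
    + exact: continuous_on_spheres_dot.
    + move=> x y xS yS /=; rewrite !oddphi// dotNl; split=> //.
      by rewrite dotC dotNl dotC.
    + by move=> x y _ _; exact: dotC.
  exists e; split=> // l; apply: orthonormal_frame_lt => [i|i j ij].
    have [phiS _ _] := hphi l.
    exact/phiS/orthonormal_frame_unit_sphere.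
  exact: e0.
- have [l|e [eON e0]] := frameP (fun l p => g l (p.1 + p.2) - g l (p.1 - p.2)).
    have [cg geven] := hg l; split.
    + exact: continuous_on_spheres_diff.
    + move=> x y _ _ /=; rewrite opprK opprB; split=> //.
      by rewrite -(geven (- x + y)) -(geven (- x - y)) !opprD !opprK.
    + by move=> x y _ _ /=; rewrite [y + x]addrC -(geven (x - y)) opprB.
  by exists e; split=> // l i j ij; apply/eqP; rewrite -subr_eq0; apply/eqP/e0.
Qed.
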